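(* Let $\mathcal{T}$ be a family of complete first-order theories in a countable language $\Sigma$ with ${\rm RS}(\mathcal{T})=\infty$, let $\alpha$ be a countable ordinal and $n\in\omega\setminus\{0\}$. Then there is a $d_\infty$-definable subfamily $\mathcal{T}^\ast\subset\mathcal{T}$ such that ${\rm RS}(\mathcal{T}^\ast)=\alpha$ and ${\rm ds}(\mathcal{T}^\ast)=n$.
   Context: All languages are predicate (relational) languages. A family of theories is a set $\mathcal{T}$ of complete first-order theories in one language $\Sigma=\Sigma(\mathcal{T})$; each theory is identified with the deductively closed set of $\Sigma$-sentences it contains. For a $\Sigma$-sentence $\varphi$, $\mathcal{T}_\varphi=\{T\in\mathcal{T}\mid\varphi\in T\}$; for a set $\Phi$ of $\Sigma$-sentences, $\mathcal{T}_\Phi=\bigcap_{\varphi\in\Phi}\mathcal{T}_\varphi=\{T\in\mathcal{T}\mid\Phi\subseteq T\}$. A subfamily of the form $\mathcal{T}_\Phi$ is called $d$-definable in $\mathcal{T}$. A subfamily of $\mathcal{T}$ is $d_\infty$-definable if it is a union of a (possibly infinite) collection $\mathcal{T}_{\Phi_i}$, $i\in I$, of $d$-definable subfamilies. Rank: ${\rm RS}(\emptyset)=-1$; ${\rm RS}(\mathcal{T})=0$ for finite nonempty $\mathcal{T}$; ${\rm RS}(\mathcal{T})\geq 1$ for infinite $\mathcal{T}$. For $\alpha=\beta+1$, ${\rm RS}(\mathcal{T})\geq\alpha$ if there are pairwise inconsistent $\Sigma$-sentences $\varphi_n$, $n\in\omega$, with ${\rm RS}(\mathcal{T}_{\varphi_n})\geq\beta$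 for all $n$. For limit $\alpha$, ${\rm RS}(\mathcal{T})\geq\alpha$ if ${\rm RS}(\mathcal{T})\geq\beta$ for all $\beta<\alpha$. ${\rm RS}(\mathcal{T})=\alpha$ if ${\rm RS}(\mathcal{T})\geq\alpha$ and ${\rm RS}(\mathcal{T})\not\geq\alpha+1$; ${\rm RS}(\mathcal{T})=\infty$ if ${\rm RS}(\mathcal{T})\geq\alpha$ for every ordinal $\alpha$. Degree: if ${\rm RS}(\mathcal{T})=\alpha\ge 0$ is an ordinal, ${\rm ds}(\mathcal{T})$ is the maximal number of pairwise inconsistent $\Sigma$-sentences $\varphi_i$ with ${\rm RS}(\mathcal{T}_{\varphi_i})=\alpha$. *)

(* Defs.v *)
From mathcomp Require Import all_boot.
From mathcomp Require Import boolp classical_sets functions cardinality wochoice.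

Set Implicit Arguments.
Unset Strict Implicit.
Unset Printing Implicit Defensive.

Local Open Scope classical_set_scope.

Record language := Language { symb :> Type; arity : symb -> nat }.

Definition countable_language (L : language) := countable [set: symb L].

(** The only terms of a relational language are variables. These are de Bruijn
    indices: index 0 under [FAll] is the variable bound by it. *)
Inductive formula (L : language) : Type :=
| FBot
| FAtom (r : symb L) of (arity r).-tuple nat
| FEq of nat & nat
| FImp of formula L & formula L
| FAll of formula L.

Arguments FBot {L}.
Arguments FEq {L}.

Definition FNot (L : language) (p : formula L) := FImp p FBot.

Definition up (f : nat -> nat) (x : nat) := if x is y.+1 then (f y).+1 else 0.

Fixpoint rename (L : language) (f : nat -> nat) (p : formula L) : formula L :=
  match p with
  | FBot => FBot
  | FAtom r v => FAtom (map_tuple f v)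
  | FEq x y => FEq (f x) (f y)
  | FImp q r => FImp (rename f q) (rename f r)
  | FAll q => FAll (rename (up f) q)
  end.

(** Replaces index 0 by the variable [x] and lowers the other indices. *)
Definition inst (L : language) (x : nat) (p : formula L) : formula L :=
  rename (fun y => if y is z.+1 then z else x) p.

(** All free indices are smaller than [n]. *)
Fixpoint closed_below (L : language) (n : nat) (p : formula L) : bool :=
  match p with
  | FBot => true
  | FAtom r v => all (fun x => x < n) v
  | FEq x y => (x < n) && (y < n)
  | FImp q r => closed_below n q && closed_below n r
  | FAll q => closed_below n.+1 q
  end.

(** Classical natural deduction. Free variables are allowed in derivations, so
    the calculus is the one for nonempty structures. *)
Reserved Notation "G |-- p" (at level 70, no associativity).
Inductive derivable (L : language) : set (formula L) -> formula L -> Prop :=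
| D_ax G p : G p -> G |-- p
| D_impI G p q : p |` G |-- q -> G |-- FImp p q
| D_impE G p q : G |-- FImp p q -> G |-- p -> G |-- q
| D_raa G p : FNot p |` G |-- FBot -> G |-- p
| D_allI G p : rename succn @` G |-- p -> G |-- FAll p
| D_allE G p x : G |-- FAll p -> G |-- inst x p
| D_eqI G x : G |-- FEq x x
| D_eqE G p x y : G |-- FEq x y -> G |-- inst x p -> G |-- inst y p
where "G |-- p" := (derivable G p).

Record sentence (L : language) :=
  Sentence { fmla :> formula L; _ : closed_below 0 fmla }.

Notation theory L := (set (sentence L)).
Notation theory_family L := (set (theory L)).

Definition proves (L : language) (T : theory L) (p : formula L) : Prop :=
  @fmla L @` T |-- p.

Definition inconsistent (L : language) (T : theory L) : Prop := proves T FBot.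

Definition consistent (L : language) (T : theory L) : Prop := ~ inconsistent T.

Definition deductively_closed (L : language) (T : theory L) : Prop :=
  forall s : sentence L, proves T s -> T s.

Definition complete_theory (L : language) (T : theory L) : Prop :=
  [/\ deductively_closed T, consistent T &
      forall s : sentence L, proves T s \/ proves T (FNot s)].

Definition family_of_complete_theories (L : language) (F : theory_family L) : Prop :=
  forall T, F T -> complete_theory T.

Definition subfamily_of_sentence (L : language) (F : theory_family L) (s : sentence L) :
  theory_family L := [set T | F T /\ T s].

Definition subfamily_of_set (L : language) (F : theory_family L) (Phi : theory L) :
  theory_family L := [set T | F T /\ Phi `<=` T].

Definition d_definable (L : language) (F G : theory_family L) : Prop :=
  exists Phi : theory L, G = subfamily_of_set F Phi.

Definition d_infty_definable (L : language) (F G : theory_family L) : Prop :=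
  exists C : set (theory_family L),
    (forall D, C D -> d_definable F D) /\ G = \bigcup_(D in C) D.

Definition pairwise_inconsistent (L : language) (I : Type) (s : I -> sentence L) :
  Prop := forall i j, i <> j -> inconsistent [set s i; s j].

(** A nonempty initial segment of the class of ordinals that is closed under
    successor, presented as a well-order. A point [a] stands for the order type
    of its strict predecessors, and every ordinal is represented by a point of
    some such segment (for instance [a] by a point of [a + omega]). *)
Record ordinal_segment := OrdinalSegment {
  ord :> Type;
  ole : rel ord;
  ole_wo : well_order ole;
  ozero : ord;
  ozero_le : forall a, ole ozero a;
  osucc : ord -> ord;
  osucc_le : forall a b, ole (osucc a) b = ~~ ole b a
}.

Arguments ozero {o}.

Definition olt (W : ordinal_segment) (a b : W) : bool := ~~ ole b a.

Definition countable_ordinal (W : ordinal_segment) (a : W) : Prop :=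
  countable [set b : W | olt b a].

Definition limit_ordinal (W : ordinal_segment) (a : W) : Prop :=
  a <> ozero /\ forall b : W, a <> osucc b.

(** [RS_ge F a] is [RS F >= a] for ordinals [a]; the value [-1] of the rank of
    the empty family amounts to the failure of [RS_ge F ozero]. *)
Inductive RS_ge (L : language) (W : ordinal_segment) : theory_family L -> W -> Prop :=
| RS_ge_zero F : F !=set0 -> RS_ge F ozero
| RS_ge_one F : infinite_set F -> RS_ge F (osucc ozero)
| RS_ge_succ F (b : W) (s : nat -> sentence L) :
    pairwise_inconsistent s ->
    (forall n, RS_ge (subfamily_of_sentence F (s n)) b) ->
    RS_ge F (osucc b)
| RS_ge_limit F (a : W) :
    limit_ordinal a -> (forall b, olt b a -> RS_ge F b) -> RS_ge F a.

Definition RS_eq (L : language) (W : ordinal_segment) (F : theory_family L) (a : W) : Prop :=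
  RS_ge F a /\ ~ RS_ge F (osucc a).

Definition RS_infty (L : language) (F : theory_family L) : Prop :=
  forall (W : ordinal_segment) (a : W), RS_ge F a.

Definition has_degree_witness (L : language) (W : ordinal_segment) (F : theory_family L)
    (a : W) (n : nat) : Prop :=
  exists s : 'I_n -> sentence L,
    pairwise_inconsistent s /\
    forall i, RS_eq (subfamily_of_sentence F (s i)) a.

(** The degree is defined relative to the ordinal rank [a] of the family. *)
Definition ds_eq (L : language) (W : ordinal_segment) (F : theory_family L) (a : W)
    (n : nat) : Prop :=
  [/\ RS_eq F a, has_degree_witness F a n &
      forall m, has_degree_witness F a m -> m <= n].

(* Main.v *)
Require Import Defs.
From mathcomp Require Import all_boot.
From mathcomp Require Import boolp classical_sets functions cardinality wochoice.

(** Topologize a family by its sentences. In a countable language this gives a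
    zero-dimensional space with a countable base, and [RS] behaves like a
    Cantor-Bendixson rank whose isolated parts need not contain their limits.
    As each complete theory [T] is alone in [F] in containing [T], every
    subfamily of [F] is d_infty-definable ([subfamily_d_infty_definable]), so
    only rank and degree matter.

    Infinite rank yields a perfect set of sentences [Q]
    ([RS_infty_perfect]): each sentence of [Q] holds in some theory of [F], can
    be split into two incompatible sentences of [Q], and for every sentence [t]
    can be strengthened by [t] or by its negation inside [Q]. Indeed the sets
    of sentences [s] with [RS F_s >= a] decrease with [a]; along an uncountable
    well-order they must repeat, and a repeated value is perfect.

    Let [e] enumerate all sentences. Descending in [Q] while deciding
    [e 0], [e 1], ... and splitting off a sentence [v k] of [Q] at each step
    gives disjoint [v k] converging to a complete type: each sentence or its
    negation holds throughout all but finitely many of the [v k]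
    ([perfect_sequence]).

    Call [G] irreducible of rank [a] when its rank is at least [a] and no
    sentence cuts it into two parts of rank at least [a]; this amounts to rank
    [a] and degree 1. By induction on a countable [a], each sentence of [Q] has
    an irreducible subfamily of rank [a] ([irreducible_subfamily]): a single
    theory for [a = 0]; otherwise the union of irreducible families of ranks
    [b k] placed under the [v k], where [b] lists every ordinal below [a]
    infinitely often. Its rank reaches [a] by the choice of [b]. Any sentence
    or its negation meets only finitely many pieces, each of rank below [a],
    and a finite union has the largest of the ranks of its members
    ([RS_ge_union]), so no sentence cuts the union in two parts of rank [a].

    The family sought is the union of [n] irreducible families of rank [alpha]
    under [v 0, ..., v (n - 1)]. The [v i], made inconsistent, witness degree
    at least [n]; conversely each of [m] pairwise inconsistent sentences cuts
    out rank [alpha] from some piece, and no piece serves two of them, so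
    [m <= n]. *)

Set Implicit Arguments.
Unset Strict Implicit.
Unset Printing Implicit Defensive.

Local Open Scope classical_set_scope.

Local Notation sub := subfamily_of_sentence.

(** * Well-order of an ordinal segment *)

Section Ordinals.
Variable W : ordinal_segment.
Implicit Types a b c : W.

Lemma ole_min (P : set W) : P !=set0 -> exists m, P m /\ forall y, P y -> ole m y.
Proof.
move=> [x Px].
have [|m [[Pm mP] _]] := @ole_wo W (fun z => `[<P z>]).
  by exists x; apply/asboolP.
by exists m; split; [apply/asboolP|move=> y Py; apply/mP/asboolP].
Qed.

Lemma ole_total a b : ole a b || ole b a.
Proof.
have [|m [[->|->] mP]] := @ole_min [set a; b]; first by exists a; left.
  by rewrite mP //; right.
by rewrite orbC mP //; left.
Qed.

Lemma olexx a : ole a a.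
Proof. by have := ole_total a a; rewrite orbb. Qed.

Lemma ole_anti a b : ole a b -> ole b a -> a = b.
Proof.
move=> ab ba; have [|m [_ uniq_m]] := @ole_wo W (fun z => `[<z = a \/ z = b>]).
  by exists a; apply/asboolP; left.
rewrite -(uniq_m a) ?(uniq_m b) //; split; try by apply/asboolP; tauto.
  by move=> z /asboolP[]->; rewrite ?olexx.
by move=> z /asboolP[]->; rewrite ?olexx.
Qed.

Lemma ole_trans a b c : ole a b -> ole b c -> ole a c.
Proof.
move=> ab bc.
have [|m [mE mP]] := @ole_min [set z | [\/ z = a, z = b | z = c]].
  by exists a; apply: Or31.
have ma := mP a (Or31 _ _ erefl).
have mb := mP b (Or32 _ _ erefl).
have mc := mP c (Or33 _ _ erefl).
case: mE => mE; subst m => //.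
  by rewrite (ole_anti ab ma).
by rewrite -(ole_anti bc mb).
Qed.

Lemma oltW a b : olt a b -> ole a b.
Proof. by rewrite /olt => /negbTE ba; have := ole_total a b; rewrite ba orbF. Qed.

Lemma olt_ole_trans a b c : olt a b -> ole b c -> olt a c.
Proof. by rewrite /olt => /negP ab bc; apply/negP => /(ole_trans bc). Qed.

Lemma olt_osucc a b : olt b (osucc a) = ole b a.
Proof. by rewrite /olt osucc_le negbK. Qed.

Lemma osucc_inj a b : osucc a = osucc b -> a = b.
Proof.
by move=> e; apply: ole_anti; rewrite -olt_osucc (e, esym e) olt_osucc olexx.
Qed.

Lemma osucc_neq0 a : osucc a <> ozero.
Proof. by move=> e; have := olt_osucc a a; rewrite e /olt ozero_le olexx. Qed.

Lemma olt_wf : well_founded (fun a b => olt a b).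
Proof.
move=> a; apply: contrapT => /= nAcc.
have [|m [nAccm mP]] := @ole_min [set z | ~ Acc (fun x y : W => olt x y) z].
  by exists a.
by apply: nAccm; constructor=> y ym; apply: contrapT => /mP; apply/negP.
Qed.

Lemma ordinal_cases a :
  [\/ a = ozero, exists b, a = osucc b | limit_ordinal a].
Proof.
have [->|a0] := pselect (a = ozero); first exact: Or31.
have [ab|nab] := pselect (exists b, a = osucc b); first exact: Or32.
by apply: Or33; split=> // b ab; apply: nab; exists b.
Qed.

End Ordinals.

(** * Countable and uncountable index sets *)

Lemma infinite_set_inj (T : Type) (A : set T) :
  infinite_set A -> exists f : nat -> T, injective f /\ forall n, A (f n).
Proof.
move=> /infiniteP/card_leP[f]; exists (fun n => val (f (to_setT n))); split.
  move=> i j /val_inj/inj; rewrite !in_setT => /(_ isT isT).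
  by move=> /(congr1 val).
by move=> n; apply: set_valP.
Qed.

Lemma no_injection_set_nat (g : set nat -> nat) : ~ injective g.
Proof.
move=> ginj; pose D : set nat := [set n | exists2 A, g A = n & ~ A n].
have nD : ~ D (g D) by move=> Dg; case: (Dg) => A /ginj -> ; apply.
by apply: (nD); exists D.
Qed.

(** A well-order of the subsets of [nat] is uncountable but may have a largest
    element; its lexicographic product with [nat] gives every point a
    successor. *)
Lemma uncountable_ordinal_segment :
  exists W : ordinal_segment, forall g : W -> nat, ~ injective g.
Proof.
have [R Rwo] := well_ordering_principle {classic (set nat)}.
have Rmin (P : set (set nat)) : P !=set0 ->
    exists m, P m /\ forall y, P y -> R m y.
  move=> [x Px]; have [|m [[Pm mP] _]] := Rwo (fun z => `[<P z>]).
    by exists x; apply/asboolP.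
  by exists m; split; [apply/asboolP|move=> y Py; apply/mP/asboolP].
have Rwc : @wo_chain {classic (set nat)} R predT by move=> A _; exact: Rwo.
have Ranti x y : R x y -> R y x -> x = y.
  by move=> xy yx; apply: (wo_chain_antisymmetric Rwc) => //; rewrite xy.
have Rxx x : R x x by apply: (wo_chain_reflexive Rwc).
have Rtot x y : R x y || R y x by apply: (wo_chainW Rwc).
pose T : Type := (set nat * nat)%type.
pose le : rel T := fun x y => R x.1 y.1 && ((~~ R y.1 x.1) || (x.2 <= y.2)).
have le_wo : well_order le.
  apply: antisymmetric_well_order.
    move=> [x i] [y j]; rewrite /le /= => /andP[/andP[xy +] /andP[yx]].
    rewrite xy yx /= (Ranti _ _ xy yx) => ij ji.
    by congr pair; apply/eqP; rewrite eqn_leq ij ji.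
  move=> A [[x0 i0] A0].
  have [|m [[i Ai] mP]] := Rmin [set x | exists i, (x, i) \in A].
    by exists x0, i0.
  have exi : exists i, (m, i) \in A by exists i.
  exists (m, ex_minn exi); case: ex_minnP => k Ak kP; split=> // -[y j] Ayj.
  rewrite /le /= mP; last by exists j.
  case: (boolP (R y m)) => //= ym; apply: kP.
  by rewrite -(Ranti _ _ ym) // mP //; exists j.
have [|m0 [_ m0P]] := Rmin setT; first by exists set0.
have zero_le a : le (m0, 0) a by rewrite /le /= m0P // orbT.
have succ_le a b : le (a.1, a.2.+1) b = ~~ le b a.
  rewrite /le /= negb_and negb_or negbK -ltnNge.
  by case: (boolP (R b.1 a.1)); have := Rtot a.1 b.1; do 2! case: (R _ _).
exists (OrdinalSegment le_wo zero_le succ_le) => /= g ginj.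
by apply: (@no_injection_set_nat (fun x => g (x, 0))) => x y /ginj[].
Qed.

(** Every element recurs infinitely often, so that a successor ordinal [b + 1]
    can be reached from infinitely many pieces of rank [b]. *)
Lemma countable_enum (T : Type) (A : set T) : countable A -> A !=set0 ->
  exists e : nat -> T, (forall k, A (e k)) /\
    forall x, A x -> exists f : nat -> nat, injective f /\ forall n, e (f n) = x.
Proof.
move=> /countable_injP[g ginj] [x0 Ax0].
have /choice[e eP] (k : nat) : exists y, A y /\
    forall x (j : nat), A x -> k = pickle (g x, j) -> y = x.
  have [[x [j [Ax kE]]]|no] :=
      pselect (exists x (j : nat), A x /\ k = pickle (g x, j)).
    exists x; split=> // y i Ay; rewrite kE => /(pcan_inj pickleK)[gxy _].
    by apply: ginj; rewrite ?inE.
  by exists x0; split=> // x j Ax kE; case: no; exists x, j.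
exists e; split=> [k|x Ax]; first by have [] := eP k.
exists (fun n => pickle (g x, n)); split=> [i j /(pcan_inj pickleK)[]//|n].
by have [_] := eP (pickle (g x, n)); apply.
Qed.

(** * Sentences and complete theories *)

Section Logic.
Variable L : language.
Implicit Types (p q : formula L) (s t : sentence L) (T : theory L).

Fixpoint formula_tree (f : L -> nat) p : GenTree.tree nat :=
  match p with
  | FBot => GenTree.Node 0 [::]
  | FAtom r v => GenTree.Node 1 (GenTree.Leaf (f r) :: map (@GenTree.Leaf nat) v)
  | FEq x y => GenTree.Node 2 [:: GenTree.Leaf x; GenTree.Leaf y]
  | FImp q r => GenTree.Node 3 [:: formula_tree f q; formula_tree f r]
  | FAll q => GenTree.Node 4 [:: formula_tree f q]
  end.

Lemma formula_tree_inj f : injective f -> injective (formula_tree f).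
Proof.
move=> finj; elim=> [|r v|x y|q IHq r IHr|q IHq] [|r' v'|x' y'|q' r'|q'] //=.
- move=> [/finj rr']; case: _ / rr' v' => v' /inj_map vv'.
  by congr FAtom; apply/val_inj/vv' => i j [].
- by move=> [-> ->].
- by move=> [/IHq -> /IHr ->].
- by move=> [/IHq ->].
Qed.

Lemma fmla_inj : injective (@fmla L).
Proof.
by move=> [p cp] [q cq] /= pq; subst q; congr Sentence; apply: bool_irrelevance.
Qed.

Lemma countable_sentences :
  countable_language L -> countable [set: sentence L].
Proof.
move=> /countable_injP[f finj]; apply/countable_injP.
exists (fun s => pickle (formula_tree f s)) => s t _ _.
move=> /(pcan_inj pickleK)/formula_tree_inj/fmla_inj; apply.
by move=> x y; apply: finj; rewrite inE.
Qed.

Lemma derivable_weaken (G H : set (formula L)) p :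
  G `<=` H -> derivable G p -> derivable H p.
Proof.
move=> GH d; elim: d H GH => {G p} [G p Gp|G p q _ IH|G p q _ IHpq _ IHp|G p _ IH|
    G p _ IH|G p x _ IH|G x|G p x y _ IHe _ IHp] H GH.
- exact/D_ax/GH.
- by apply/D_impI/IH; apply: setUS.
- by apply: D_impE (IHpq _ GH) (IHp _ GH).
- by apply/D_raa/IH; apply: setUS.
- by apply/D_allI/IH; apply: image_subset.
- exact/D_allE/IH.
- exact: D_eqI.
- exact: D_eqE (IHe _ GH) (IHp _ GH).
Qed.

Definition FAnd p q := FNot (FImp p (FNot q)).

Lemma FAndl (G : set (formula L)) p q : derivable G (FAnd p q) -> derivable G p.
Proof.
move=> d; apply: D_raa; apply: D_impE (derivable_weaken _ d) _.
  exact: subsetUr.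
apply/D_impI/D_raa; apply: (@D_impE _ _ p); apply: D_ax.
  by right; right; left.
by right; left.
Qed.

Lemma FAndr (G : set (formula L)) p q : derivable G (FAnd p q) -> derivable G q.
Proof.
move=> d; apply: D_raa; apply: D_impE (derivable_weaken _ d) _.
  exact: subsetUr.
by apply/D_impI/D_ax; right; left.
Qed.

Definition top_sentence : sentence L := @Sentence L (FNot FBot) isT.

Lemma closed_FNot s : closed_below 0 (FNot s).
Proof. by case: s => p /= ->. Qed.

Definition not_sentence s : sentence L := Sentence (closed_FNot s).

Lemma closed_FImp s t : closed_below 0 (FImp s t).
Proof. by case: s t => p /= -> [q /= ->]. Qed.

Definition imp_sentence s t : sentence L := Sentence (closed_FImp s t).

Definition and_sentence s t : sentence L :=
  not_sentence (imp_sentence s (not_sentence t)).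

Section Complete.
Variable T : theory L.
Hypothesis cT : complete_theory T.

Lemma proves_ax s : T s -> proves T s.
Proof. by move=> Ts; apply: D_ax; exists s. Qed.

Lemma inconsistent_disjoint s t : inconsistent [set s; t] -> T s -> T t -> False.
Proof.
have [_ consT _] := cT.
move=> ic Ts Tt; apply: consT; apply: derivable_weaken ic.
by apply: image_subset => _ [->|->].
Qed.

Lemma in_not s : T (not_sentence s) <-> ~ T s.
Proof.
have [closedT consT completeT] := cT; split=> [Tns Ts|nTs].
  by apply: consT; exact: D_impE (proves_ax Tns) (proves_ax Ts).
by have [/closedT|/(closedT (not_sentence s))] := completeT s.
Qed.

Lemma in_imp s t : T (imp_sentence s t) <-> (T s -> T t).
Proof.
have [closedT consT completeT] := cT; split=> [Tst Ts|Tst]; apply: closedT.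
  exact: D_impE (proves_ax Tst) (proves_ax Ts).
have [Ts|/in_not Tns] := pselect (T s).
  by apply/D_impI/D_ax; right; exists t => //; exact: Tst.
apply/D_impI/D_raa; apply: (@D_impE _ _ s); apply: D_ax.
  by right; right; exists (not_sentence s).
by right; left.
Qed.

Lemma in_and s t : T (and_sentence s t) <-> T s /\ T t.
Proof.
rewrite in_not in_imp in_not; split=> [nst|[Ts Tt] /(_ Ts)]; last exact.
by apply: contrapT => nT; apply: nst => Ts Tt; apply: nT.
Qed.

Lemma in_top : T top_sentence.
Proof. by have [closedT _ _] := cT; apply/closedT/D_impI/D_ax; left. Qed.

End Complete.

Lemma complete_theory_sub T T' :
  complete_theory T -> complete_theory T' -> T `<=` T' -> T = T'.
Proof.
move=> cT cT' TT'; apply/seteqP; split=> // s T's; apply: contrapT => /(in_not cT).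
by move=> /TT'/(in_not cT').
Qed.

Fixpoint minus_first (v : nat -> sentence L) s (j : nat) : sentence L :=
  if j is i.+1 then and_sentence (minus_first v s i) (not_sentence (v i)) else s.

(** Turns sentences that merely exclude each other in the theories of a family
    into sentences that are inconsistent by derivation, as degree and rank
    require. *)
Definition first_in v k := minus_first v (v k) k.

Lemma in_minus_first T v s j : complete_theory T ->
  T (minus_first v s j) <-> T s /\ forall i, i < j -> ~ T (v i).
Proof.
move=> cT; elim: j => [|j IH] /=; first by split=> [|[]].
rewrite in_and // in_not // IH; split=> [[[Ts Tj] nTvj]|[Ts Tj]].
  by split=> // i; rewrite ltnS leq_eqVlt => /predU1P[->//|/Tj].
by split; [split=> // i ij; apply/Tj/ltnW|exact: Tj].
Qed.

Lemma derivable_minus_first (G : set (formula L)) v s j :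
  derivable G (minus_first v s j) ->
  derivable G s /\ forall i, i < j -> derivable G (FNot (v i)).
Proof.
elim: j => [|j IH] //= d.
have [Gs Gj] := IH (FAndl d); split=> // i.
by rewrite ltnS leq_eqVlt => /predU1P[->|/Gj//]; exact: FAndr d.
Qed.

Lemma pairwise_inconsistent_first_in v : pairwise_inconsistent (first_in v).
Proof.
have lt_inc i j (G : set (formula L)) : i < j ->
    G (first_in v i) -> G (first_in v j) -> derivable G FBot.
  move=> ij /D_ax/derivable_minus_first[Gi _].
  by move=> /D_ax/derivable_minus_first[_ /(_ i ij) Gj]; apply: D_impE Gj Gi.
move=> i j ij; have Gi : (@fmla L @` [set first_in v i; first_in v j]) (first_in v i).
  by exists (first_in v i) => //; left.
have Gj : (@fmla L @` [set first_in v i; first_in v j]) (first_in v j).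
  by exists (first_in v j) => //; right.
by case: (ltngtP i j) => // [ij'|ji]; [apply: lt_inc ij' Gi Gj|apply: lt_inc ji Gj Gi].
Qed.

(** * Rank of a family *)

Section Rank.
Variable W : ordinal_segment.
Implicit Types (A B F G H : theory_family L) (a b c : W).

Lemma sub_mono A B s : A `<=` B -> sub A s `<=` sub B s.
Proof. by move=> AB T [/AB]. Qed.

Lemma RS_ge_mono A B a : A `<=` B -> RS_ge A a -> RS_ge B a.
Proof.
move=> AB d; elim: d B AB => {A a}
    [A [T AT]|A Ainf|A b s sP _ IH|A a alim _ IH] B AB.
- by apply: RS_ge_zero; exists T; apply: AB.
- by apply: RS_ge_one; apply: sub_infinite_set Ainf.
- by apply: (RS_ge_succ sP) => n; apply: IH; apply: sub_mono.
- by apply: RS_ge_limit => // b /IH; apply.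
Qed.

Lemma RS_ge_nonempty A a : RS_ge A a -> A !=set0.
Proof.
elim=> {A a} // [A Ainf|A b s _ _ IH|A a [a0 _] _ IH].
- exact: infinite_setN0.
- by have [T [AT _]] := IH 0; exists T.
- apply: (IH ozero); rewrite /olt; apply/negP => a_le; apply: a0.
  exact: ole_anti (ozero_le a).
Qed.

Lemma RS_ge_le A a b : ole b a -> RS_ge A a -> RS_ge A b.
Proof.
move=> ba d; elim: d b ba => {A a}
    [A A0|A Ainf|A c s sP sge IH|A a alim age IH] b ba.
- by rewrite (ole_anti ba (ozero_le _)); exact: RS_ge_zero.
- have [->|b1] := pselect (b = osucc ozero); first exact: RS_ge_one.
  have b0 : ole b ozero.
    by rewrite -olt_osucc; apply/negP => /(ole_anti ba).
  by rewrite (ole_anti b0 (ozero_le _)); apply/RS_ge_zero/infinite_setN0.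
- have [->|b1] := pselect (b = osucc c); first exact: RS_ge_succ sge.
  apply: (@RS_ge_mono (sub A (s 0))); first by move=> T [].
  by apply: IH; rewrite -olt_osucc; apply/negP => /(ole_anti ba).
- have [->|bNa] := pselect (b = a); first exact: RS_ge_limit age.
  by apply: age; apply/negP => /(ole_anti ba).
Qed.

(** In the successor step a sequence of witnesses for the union serves one of the
    two families infinitely often; in the limit step, failures of both families
    below the limit would contradict the claim at the larger of the two ordinals
    at which they fail. *)
Lemma RS_ge_union A B a : RS_ge (A `|` B) a -> RS_ge A a \/ RS_ge B a.
Proof.
move E : (A `|` B) => U d; elim: d A B E => {U a}
    [U [T UT]|U Uinf|U b s sP _ IH|U a alim _ IH] A B UE; subst.
- by case: UT => [AT|BT]; [left|right]; apply: RS_ge_zero; exists T.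
- have [Afin|Ainf] := pselect (finite_set A); last by left; apply: RS_ge_one.
  by right; apply: RS_ge_one => Bfin; apply: Uinf; rewrite finite_setU.
- have IH' n : RS_ge (sub A (s n)) b \/ RS_ge (sub B (s n)) b.
    apply: (IH n); apply/seteqP; split=> T; rewrite /sub /=; tauto.
  have inf (C : theory_family L) : infinite_set [set n | RS_ge (sub C (s n)) b] -> RS_ge C (osucc b).
    move=> /infinite_set_inj[f [finj fP]].
    apply: (@RS_ge_succ _ _ _ _ (s \o f)) => // i j ij.
    by apply: sP => /finj.
  have [Afin|/inf] := pselect (finite_set [set n | RS_ge (sub A (s n)) b]);
    last by left.
  right; apply: inf => Bfin; apply: infinite_nat.
  apply: (@sub_finite_set _ _ ([set n | RS_ge (sub A (s n)) b] `|`
    [set n | RS_ge (sub B (s n)) b])); first by move=> n _; exact: IH'.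
  by rewrite finite_setU.
- apply: contrapT => nAB.
  have below (C : theory_family L) : ~ RS_ge C a -> exists2 b, olt b a & ~ RS_ge C b.
    move=> nC; apply: contrapT => nb; apply: nC; apply: RS_ge_limit => // b ba.
    by apply: contrapT => nCb; apply: nb; exists b.
  have [b ba nAb] := below A (fun h => nAB (or_introl h)).
  have [c ca nBc] := below B (fun h => nAB (or_intror h)).
  have [bc|cb] := orP (ole_total b c).
    by have [/(RS_ge_le bc)|] := IH c ca A B erefl.
  by have [|/(RS_ge_le cb)] := IH b ba A B erefl.
Qed.

Lemma RS_ge_bigcup (G : nat -> theory_family L) n a :
  RS_ge (\bigcup_(i in `I_n) G i) a -> exists2 i, i < n & RS_ge (G i) a.
Proof.
elim: n => [|n IH].
  by rewrite II0 bigcup_set0 => /RS_ge_nonempty[].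
rewrite IIS bigcup_setU bigcup_set1 => /RS_ge_union[/IH[i ilt]|ge].
  by exists i => //; exact: ltnW.
by exists n.
Qed.

Lemma RS_ge_decide F s a : family_of_complete_theories F -> RS_ge F a ->
  RS_ge (sub F s) a \/ RS_ge (sub F (not_sentence s)) a.
Proof.
move=> cF ge; apply: RS_ge_union; apply: RS_ge_mono ge => T FT.
have [Ts|nTs] := pselect (T s); first by left.
by right; split=> //; apply/(in_not (cF T FT)).
Qed.

(** Two members of an infinite sequence of pairwise inconsistent sentences
    suffice, and one of them may be replaced by the negation of the other. For
    [a = 0] a sentence on which two theories of the family differ will do. *)
Lemma RS_ge_split F a : family_of_complete_theories F -> RS_ge F (osucc a) ->
  exists s, RS_ge (sub F s) a /\ RS_ge (sub F (not_sentence s)) a.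
Proof.
move=> cF; move E : (osucc a) => a' d.
case: d cF E => {F a'} [F _|F Finf|F b s sP sge|F a' [_ alim] _] cF E.
- by case: (osucc_neq0 E).
- have -> := osucc_inj E.
  have [f [finj Ff]] := infinite_set_inj Finf.
  have [s [s0 s1]] : exists s, f 0 s /\ ~ f 1 s.
    apply: contrapT => no; suff : f 0 = f 1 by move=> /finj.
    apply: complete_theory_sub; [exact: cF|exact: cF|].
    by move=> s s0; apply: contrapT => s1; apply: no; exists s.
  exists s; split; apply: RS_ge_zero; first by exists (f 0).
  by exists (f 1); split=> //; apply/in_not => //; exact: cF.
- have -> := osucc_inj E; exists (s 0); split; first exact: sge.
  apply: RS_ge_mono (sge 1) => T [FT T1]; split=> //.
  apply/in_not; first exact: cF.
  by move=> T0; apply: (inconsistent_disjoint (cF T FT) (sP 0 1 _) T0 T1).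
- by case: (alim a).
Qed.

(** The inductive form of rank [a] and degree 1, stated without reference to
    the successor of [a]. *)
Definition rank_irreducible G a :=
  RS_ge G a /\ forall s, ~ (RS_ge (sub G s) a /\ RS_ge (sub G (not_sentence s)) a).

Lemma rank_irreducible_lt_succ G a : family_of_complete_theories G ->
  rank_irreducible G a -> ~ RS_ge G (osucc a).
Proof. by move=> cG [_ irr] /(RS_ge_split cG)[s /irr]. Qed.

End Rank.

(** * Perfect sets of sentences *)

Section Perfect.
Variable F : theory_family L.
Hypothesis cF : family_of_complete_theories F.

Lemma sub_and s t : sub F (and_sentence s t) = sub (sub F s) t.
Proof.
apply/seteqP; split=> T.
  by move=> [FT /(in_and (cF FT))[Ts Tt]].
by move=> [[FT Ts] Tt]; split=> //; apply/(in_and (cF FT)).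
Qed.

Lemma complete_sub G : G `<=` F -> family_of_complete_theories G.
Proof. by move=> GF T /GF/cF. Qed.

Definition perfect_sentences (Q : set (sentence L)) :=
  [/\ forall s, Q s -> sub F s !=set0,
      forall s t, Q s -> Q (and_sentence s t) \/ Q (and_sentence s (not_sentence t)) &
      forall s, Q s -> exists t,
        Q (and_sentence s t) /\ Q (and_sentence s (not_sentence t))].

(** If every step from [a] to its successor lost some sentence [s] with
    [RS F_s >= a], the lost sentences would be pairwise distinct and inject an
    uncountable well-order into a countable set. At a step where none is lost,
    [RS_ge_split] splits every remaining sentence. *)
Lemma RS_infty_perfect : countable [set: sentence L] -> RS_infty F ->
  exists2 Q, perfect_sentences Q & Q top_sentence.
Proof.
move=> /countable_injP[g ginj] Finf.
have [W Wunc] := uncountable_ordinal_segment.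
have [a aP] : exists a : W, forall s, RS_ge (sub F s) a -> RS_ge (sub F s) (osucc a).
  apply: contrapT => no.
  have /choice[h hP] (a : W) :
      exists s, RS_ge (sub F s) a /\ ~ RS_ge (sub F s) (osucc a).
    apply: contrapT => nos; apply: no; exists a => s ge.
    by apply: contrapT => nge; apply: nos; exists s.
  (* [h b] survives beyond [a] when [a < b], whereas [h a] is lost there. *)
  have hlt a b : olt a b -> h a <> h b.
    move=> ab hab; have [_] := hP a; rewrite hab; apply.
    by have [+ _] := hP b; apply: RS_ge_le; rewrite osucc_le.
  apply: (Wunc (g \o h)) => a b /ginj; rewrite !inE => /(_ I I) hab.
  have [ba|/hlt] := boolP (ole b a); last by rewrite hab.
  have [ab|/hlt] := boolP (ole a b); last by rewrite hab.
  exact: ole_anti.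
have sF s : sub F s `<=` F by move=> T [].
exists [set s | RS_ge (sub F s) a].
  split=> /= [s /RS_ge_nonempty //|s t|s /aP ge].
    by rewrite !sub_and; apply: RS_ge_decide; exact: complete_sub.
  have [t] := RS_ge_split (complete_sub (@sF s)) ge.
  by exists t; rewrite !sub_and.
apply: RS_ge_mono (Finf W a) => T FT; split=> //; exact: in_top (cF FT).
Qed.

(** The [v j] with [j > k] lie below a sentence of [Q] that decides [e k] and
    excludes [v k]: each step strengthens the current sentence to decide [e k],
    then splits it, keeping one half and setting the other aside as [v k]. *)
Lemma perfect_sequence Q (e : nat -> sentence L) s :
  perfect_sentences Q -> Q s ->
  exists v : nat -> sentence L,
    [/\ forall k, Q (v k),
        forall k, sub F (v k) `<=` sub F s,
        forall i j T, F T -> i < j -> T (v j) -> ~ T (v i) &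
        forall k, (forall j T, F T -> k < j -> T (v j) -> T (e k)) \/
                  (forall j T, F T -> k < j -> T (v j) -> ~ T (e k))].
Proof.
move=> [_ Qdec Qsplit] Qs.
have /choice[g gP] (x : nat * sentence L) : exists y : sentence L * sentence L,
    Q x.2 -> [/\ Q y.1, Q y.2,
      forall T, F T -> T y.1 -> T x.2 /\ ~ T y.2,
      forall T, F T -> T y.2 -> T x.2 &
      (forall T, F T -> T y.1 -> T (e x.1)) \/
      (forall T, F T -> T y.1 -> ~ T (e x.1))].
  case: x => k u /=.
  have [Qu|nQu] := pselect (Q u); last by exists (u, u) => /nQu.
  have [d [Qd dP]] : exists d, Q (and_sentence u d) /\
      ((forall T, F T -> T d -> T (e k)) \/ (forall T, F T -> T d -> ~ T (e k))).
    have [Qe|Qne] := Qdec u (e k) Qu.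
      by exists (e k); split=> //; left.
    by exists (not_sentence (e k)); split=> //; right=> T FT /(in_not (cF FT)).
  have [t [Qt Qnt]] := Qsplit _ Qd.
  exists (and_sentence (and_sentence u d) (not_sentence t),
          and_sentence (and_sentence u d) t) => _ /=; split=> // [T FT|T FT|].
  - have cT := cF FT; rewrite !in_and // in_not //; tauto.
  - have cT := cF FT; rewrite !in_and //; tauto.
  - by case: dP => dP; [left|right] => T FT;
      have cT := cF FT; rewrite !in_and // => -[[_ /(dP T FT)]].
(* [U] keeps the halves that are not set aside. *)
pose U := fix U k := if k is j.+1 then (g (j, U j)).1 else s.
pose v k := (g (k, U k)).2.
have QU k : Q (U k) by elim: k => [|k /(gP (k, _))[]].
have Umono i j T : F T -> i <= j -> T (U j) -> T (U i).
  move=> FT /subnK<-; elim: (j - i) => [|k IH] //= Tk; apply: IH.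
  by have [_ _ /(_ T FT Tk)[]] := gP (k + i, _) (QU (k + i)).
have vU k T : F T -> T (v k) -> T (U k).
  by move=> FT; have [_ _ _ h _] := gP (k, _) (QU k); exact: h.
exists v; split=> [k|k T [FT Tv]|i j T FT ij Tvj|k].
- by have [] := gP (k, _) (QU k).
- by split=> //; apply: (Umono 0 k) => //; exact: vU.
- have Ti1 : T (U i.+1) by apply: Umono ij _ => //; exact: vU.
  by have [_ _ /(_ T FT Ti1)[]] := gP (i, _) (QU i).
- by have [_ _ _ _ []] := gP (k, _) (QU k) => dP; [left|right] => j T FT kj Tvj;
    apply: dP => //; apply: (Umono k.+1 j) => //; exact: vU.
Qed.

Lemma sub_first_in v k :
  (forall i j T, F T -> i < j -> T (v j) -> ~ T (v i)) ->
  sub F (v k) `<=` sub F (first_in v k).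
Proof.
move=> vdisj T [FT Tv]; split=> //; apply/in_minus_first; first exact: cF.
by split=> // i ik; apply: vdisj ik Tv.
Qed.

(** The pieces [G k] have ranks below [a] and accumulate only at the type to
    which the [v k] converge; any sentence either belongs to this type
    or has its negation there, so one of its two parts meets only finitely many
    pieces and has rank below [a]. *)
Lemma irreducible_subfamily (W : ordinal_segment) Q (a : W) s :
  countable [set: sentence L] -> perfect_sentences Q -> countable_ordinal a -> Q s ->
  exists2 G, G `<=` sub F s & rank_irreducible G a.
Proof.
move=> cS QP; elim/(well_founded_ind (@olt_wf W)): a s => a IH s ca Qs.
have [a0|/negP a0] := boolP (ole a ozero).
  have [Q0 _ _] := QP; have [T FT] := Q0 s Qs; exists [set T]; first by move=> _ ->.
  rewrite (ole_anti a0 (ozero_le a)); split; first by apply: RS_ge_zero; exists T.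
  move=> t [/RS_ge_nonempty[_ [-> Tt]] /RS_ge_nonempty[_ [->]]].
  by move=> /in_not; apply => //; case: FT => /cF.
have [b [bP bsurj]] : exists b : nat -> W, (forall k, olt (b k) a) /\
    forall c, olt c a -> exists f : nat -> nat, injective f /\ forall n, b (f n) = c.
  by apply: (countable_enum ca); exists ozero; apply/negP.
have [e [_ esurj]] := countable_enum cS (ex_intro _ s I).
have [v [Qv vs vdisj vdec]] := perfect_sequence e QP Qs.
have /choice[G GP] k : exists G, G `<=` sub F (v k) /\ rank_irreducible G (b k).
  have [|G] := IH (b k) (bP k) (v k) _ (Qv k); last by exists G.
  apply: sub_countable ca; apply: subset_card_le => c /= cb.
  by apply: olt_ole_trans cb (oltW (bP k)).
have Gv k : G k `<=` sub F (v k) by have [] := GP k.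
have GF k : G k `<=` F by move=> T /Gv[].
pose H := \bigcup_k G k.
have GH k : G k `<=` H by exact: bigcup_sup.
exists H; first by move=> T [k _ /Gv/vs].
have Hge c : olt c a -> exists f : nat -> nat, injective f /\
    forall n, RS_ge (sub H (first_in v (f n))) c.
  move=> /bsurj[f [finj fb]]; exists f; split=> // n.
  have [_ [+ _]] := GP (f n); rewrite fb; apply: RS_ge_mono => T GT.
  by have [] := sub_first_in vdisj (Gv _ _ GT); split=> //; exact: GH GT.
split.
  have [az|[c ac]|alim] := ordinal_cases a.
  - by case: a0; rewrite az ozero_le.
  - have [|f [finj fP]] := Hge c; first by rewrite ac olt_osucc olexx.
    rewrite ac; apply: (RS_ge_succ _ fP) => i j ij.
    by apply: pairwise_inconsistent_first_in => /finj.
  - apply: RS_ge_limit => // c /Hge[f [_ /(_ 0)]].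
    by apply: RS_ge_mono => T [].
(* A sentence excluded by all [v j] with [j > k] meets at most the pieces
   [G 0, ..., G k]. *)
have Hlow k (t : sentence L) : (forall j T, F T -> k < j -> T (v j) -> ~ T t) ->
    ~ RS_ge (sub H t) a.
  move=> later ge.
  have [|j _] := @RS_ge_bigcup _ G k.+1 a.
    apply: RS_ge_mono ge => T [[j _ GT] Tt]; exists j => //=.
    rewrite ltnNge; apply/negP => kj.
    by have [FT Tv] := Gv _ _ GT; apply: later kj Tv Tt.
  have [_ irr] := GP j.
  move=> /(@RS_ge_le _ _ _ (osucc (b j))); rewrite osucc_le => /(_ (bP j)).
  exact: (rank_irreducible_lt_succ (complete_sub (@GF j)) irr).
move=> t [tge nge].
have [f [_ /(_ 0) ft]] := esurj t I.
have [dec|dec] := vdec (f 0); last by apply: (Hlow _ _ dec); rewrite ft.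
apply: (Hlow (f 0) (not_sentence (e (f 0)))); last by rewrite ft.
by move=> j T FT kj Tv; rewrite in_not; [apply; exact: dec kj Tv|exact: cF].
Qed.

(** A complete theory contained in another one equals it, so [[set T]] is the
    subfamily of [F] defined by [T] itself. *)
Lemma subfamily_d_infty_definable G : G `<=` F -> d_infty_definable F G.
Proof.
move=> GF; exists [set D | exists2 T, G T & D = [set T]]; split.
  move=> _ [T GT ->]; exists T; apply/seteqP; split.
    by move=> _ ->; split=> //; exact: GF.
  move=> T' [FT' TT']; apply/esym/complete_theory_sub => //; apply: cF => //.
  exact: GF.
apply/seteqP; split=> [T GT|T [_ [T' GT' ->] ->]//].
by exists [set T] => //; exists T.
Qed.

End Perfect.

End Logic.

Theorem theorem4p8 (L : language) (F : theory_family L) (W : ordinal_segment) (alpha : W)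
    (n : nat) :
  countable_language L ->
  family_of_complete_theories F ->
  RS_infty F ->
  countable_ordinal alpha ->
  0 < n ->
  exists G : theory_family L,
    [/\ G `<=` F, d_infty_definable F G, RS_eq G alpha & ds_eq G alpha n].
Proof.
move=> cL cF Finf ca n0; have cS := countable_sentences cL.
have [Q QP Qtop] := RS_infty_perfect cF cS Finf.
have [v [Qv _ vdisj _]] := perfect_sequence cF (fun=> top_sentence L) QP Qtop.
have /choice[G GP] k : exists G, G `<=` sub F (v k) /\ rank_irreducible G alpha.
  by have [G] := irreducible_subfamily cF cS QP ca (Qv k); exists G.
have Gv k : G k `<=` sub F (v k) by have [] := GP k.
have irr k : rank_irreducible (G k) alpha by have [] := GP k.
pose H := \bigcup_(i in `I_n) G i.
have HF : H `<=` F by move=> T [k _ /Gv[]].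
have Gfirst k : k < n -> G k `<=` sub H (first_in v k).
  move=> kn T GT; have [_] := sub_first_in cF vdisj (Gv _ _ GT).
  by split=> //; exists k.
have Hnot : ~ RS_ge H (osucc alpha).
  move=> /RS_ge_bigcup[k _]; apply: rank_irreducible_lt_succ (irr k).
  by apply: (complete_sub cF) => T /Gv[].
have Hsub s : sub H s `<=` H by move=> T [].
have Heq s k : k < n -> G k `<=` sub H s -> RS_eq (sub H s) alpha.
  move=> kn Gs; have [ge _] := irr k; split; first exact: RS_ge_mono ge.
  by move=> /(RS_ge_mono (@Hsub s)).
have RSH : RS_eq H alpha.
  split=> //; have [ge _] := irr 0; apply: RS_ge_mono ge => T GT; by exists 0.
exists H; split=> //; first exact: subfamily_d_infty_definable.
split=> // [|m [s [sP seq]]].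
  exists (fun i => first_in v i); split=> [i j ij|i].
    by apply: pairwise_inconsistent_first_in => /val_inj.
  by apply: (@Heq _ i) => //; exact: Gfirst.
(* Sending each of the [m] sentences to a piece from which it cuts out rank
   [alpha] is injective, because the pieces are irreducible. *)
have /choice[f fP] (i : 'I_m) : exists j : 'I_n, RS_ge (sub (G j) (s i)) alpha.
  have [ge _] := seq i.
  have [|j jn jge] := @RS_ge_bigcup _ _ (fun j => sub (G j) (s i)) n alpha.
    by apply: RS_ge_mono ge => T [[j jn GT] Ts]; exists j.
  by exists (Ordinal jn).
rewrite -[m]card_ord -[n]card_ord; apply: (leq_card f) => i j fij.
apply: contrapT => ij; have [_] := irr (f i); apply; split; first exact: fP.
move: (fP j); rewrite -fij; apply: RS_ge_mono => T [GT Tj]; split=> //.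
have cT : complete_theory T by apply: cF; case: (Gv _ _ GT).
apply/(in_not cT) => Ti; exact: (inconsistent_disjoint cT (sP i j ij) Ti Tj).
Qed.
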